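(* Consider three goods, the three price vectors $P^1=(2,1,4)'$, $P^2=(2,1,2)'$, $P^3=(2,2,1)'$, and the three Engel curves $q^1(x)=(1,0,0)'x$, $q^2(x)=(0,1,0)'x$, $q^3(x)=(0,0,1)'x$ ($x>0$), where $q^t$ corresponds to $P^t$; these curves are weakly normal. Let $X^t=q^t(1)$ for $t=1,2,3$, let $P^4=(1,1,1)'$ and $x_4=2$. The intersection demands, defined by $\langle P^4,q^t(\tilde x_t)\rangle=x_4$, are given by $\tilde x_1=\tilde x_2=\tilde x_3=2$. Then $$G(P^4,x_4,\{\tilde x_t\}_{t=1}^3)=\left\{X\in\mathbb{R}^3_+ : X_1\ge 0,\ X_2\ge 0,\ X_1\le 2-\tfrac32 X_2,\ X_3=2-X_1-X_2\right\},$$ $$K_H^1(P^4,x_4)=\left\{X\in\mathbb{R}^3_+ : X_2=0,\ 0\le X_1\le 2,\ X_3=2-X_1\right\},$$ so that $K_H^1(P^4,x_4)$ is a proper subset of $G(P^4,x_4,\{\tilde x_t\}_{t=1}^3)$. Moreover, it is not true that the inclusion $$S(P^4,x_4,\{\tilde x_t\}_{t=1}^3)\subseteq S(P^4,x_4,\{x_t\}_{t=1}^3)$$ holds for all $x_1,x_2,x_3>0$.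
   Context: Notation: $\langle\cdot,\cdot\rangle$ is the scalar product and $\mathbb{R}^m_+=\{X\in\mathbb{R}^m : X\ge 0,\ X\ne 0\}$ (componentwise inequality); here $m=3$. A trade statistics is a finite family $\{(P^t,X^t)\}_{t=1}^T$ of pairs (price vector, consumption vector). For a trade statistics, write $X^t R X^s$ if $\langle P^t,X^t\rangle\ge\langle P^t,X^s\rangle$, and let $R^*$ be the transitive closure of $R$ (as a relation on the observations $1,\dots,T$). - GARP: for all $t,s$, $X^tR^*X^s$ implies $\langle P^s,X^s\rangle\le\langle P^s,X^t\rangle$. - SARP: for all $t,s$, $X^tR^*X^s$ and $X^t\neq X^s$ imply $\langle P^s,X^s\rangle<\langle P^s,X^t\rangle$. - HARP: for all finite sequences of indices $t_1,\dots,t_k$ in $\{1,\dots,T\}$, $\langle P^{t_1},X^{t_2}\rangle\langle P^{t_2},X^{t_3}\rangle\cdots\langle P^{t_k},X^{t_1}\rangle\ge\langle P^{t_1},X^{t_1}\rangle\langle P^{t_2},X^{t_2}\rangle\cdots\langle P^{t_k},X^{t_k}\rangle$. An Engel curve $q^t$ corresponding to the price vector $P^t$ is a function from $(0,\infty)$ to consumption vectors; the curves are weakly normal if $x>x'$ implies $q^t(x)\ge q^t(x')$ componentwise for all $t$. (In this example the parameter $x$ is a scalar parametrizing the curve, not normalized to equal the expenditure $\langle P^t,q^t(x)\rangle$.) For given $P^1,\dots,P^T$, $q^1,\dots,q^T$, a new price vector $P^{T+1}$, an expenditure $x_{T+1}>0$ and parameters $x_1,\dots,x_T>0$ (here $T=3$):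 - $S(P^{T+1},x_{T+1},\{x_t\}_{t=1}^T)$ is the set of $X\in\mathbb{R}^m_+$ with $\langle P^{T+1},X\rangle=x_{T+1}$ such that $\{(P^t,q^t(x_t))\}_{t=1}^T\cup\{(P^{T+1},X)\}$ satisfies SARP; - $G(P^{T+1},x_{T+1},\{x_t\}_{t=1}^T)$ is the set of $X\in\mathbb{R}^m_+$ with $\langle P^{T+1},X\rangle=x_{T+1}$ such that $\{(P^t,q^t(x_t))\}_{t=1}^T\cup\{(P^{T+1},X)\}$ satisfies GARP; - $K_H^1(P^{T+1},x_{T+1})$ is the set of $X\in\mathbb{R}^m_+$ with $\langle P^{T+1},X\rangle=x_{T+1}$ such that $\{(P^t,X^t)\}_{t=1}^T\cup\{(P^{T+1},X)\}$ satisfies HARP, where $X^t$ are the observed demands. *)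

(* Defs.v *)
From Stdlib Require Import Relation_Operators.
From mathcomp Require Import all_boot all_order all_algebra.
From mathcomp Require Import boolp classical_sets reals.

Set Implicit Arguments.
Unset Strict Implicit.
Unset Printing Implicit Defensive.

Import Order.TTheory GRing.Theory Num.Theory.
Local Open Scope classical_set_scope.
Local Open Scope ring_scope.

Definition dotv (R : realType) (m : nat) (p x : 'cV[R]_m) : R :=
  \sum_(i < m) p i 0 * x i 0.

Definition lev (R : realType) (m : nat) (x y : 'cV[R]_m) : Prop :=
  forall i, x i 0 <= y i 0.

(* R^m_+ : the nonnegative orthant without the origin. *)
Definition orthant (R : realType) (m : nat) : set 'cV[R]_m :=
  [set X | lev 0 X /\ X != 0].

(* A trade statistics with T observations is a pair of families
   P, X : 'I_T -> 'cV[R]_m of price and consumption vectors. *)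

(* R relates the observations (indices), not the consumption vectors. *)
Definition revealed (R : realType) (m T : nat) (P X : 'I_T -> 'cV[R]_m)
    (t s : 'I_T) : Prop :=
  dotv (P t) (X t) >= dotv (P t) (X s).

Definition revealed_star (R : realType) (m T : nat) (P X : 'I_T -> 'cV[R]_m)
    : 'I_T -> 'I_T -> Prop :=
  clos_trans 'I_T (revealed P X).

Definition GARP (R : realType) (m T : nat) (P X : 'I_T -> 'cV[R]_m) : Prop :=
  forall t s, revealed_star P X t s -> dotv (P s) (X s) <= dotv (P s) (X t).

Definition SARP (R : realType) (m T : nat) (P X : 'I_T -> 'cV[R]_m) : Prop :=
  forall t s, revealed_star P X t s -> X t <> X s ->
    dotv (P s) (X s) < dotv (P s) (X t).

(* ordS is the cyclic successor on 'I_k, so the last factor on the left is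
   <P^{t_k}, X^{t_1}>.  For k = 0 the inequality reads 1 >= 1. *)
Definition HARP (R : realType) (m T : nat) (P X : 'I_T -> 'cV[R]_m) : Prop :=
  forall (k : nat) (t : 'I_k -> 'I_T),
    \prod_(i < k) dotv (P (t i)) (X (t (ordS i))) >=
    \prod_(i < k) dotv (P (t i)) (X (t i)).

(* The family v^1, ..., v^T followed by v^{T+1} = w. *)
Definition extend (V : Type) (T : nat) (v : 'I_T -> V) (w : V) : 'I_T.+1 -> V :=
  fun i => if unlift ord_max i is Some j then v j else w.

(* Curves are functions on (0, +oo); here they are total functions on R of
   which only the values at positive parameters are ever used. *)
Definition engel_curve (R : realType) (m : nat) (q : R -> 'cV[R]_m) : Prop :=
  forall x, 0 < x -> orthant (q x).

Definition weakly_normal (R : realType) (m T : nat)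
    (q : 'I_T -> R -> 'cV[R]_m) : Prop :=
  forall t x x', 0 < x' -> x' < x -> lev (q t x') (q t x).

Definition budget (R : realType) (m : nat) (p : 'cV[R]_m) (e : R)
    : set 'cV[R]_m :=
  [set X | orthant X /\ dotv p X = e].

(* In the three support sets, p = P^{T+1} and e = x_{T+1}. *)
Definition supportS (R : realType) (m T : nat) (P : 'I_T -> 'cV[R]_m)
    (q : 'I_T -> R -> 'cV[R]_m) (p : 'cV[R]_m) (e : R) (x : 'I_T -> R)
    : set 'cV[R]_m :=
  [set X | budget p e X /\ SARP (extend P p) (extend (fun t => q t (x t)) X)].

Definition supportG (R : realType) (m T : nat) (P : 'I_T -> 'cV[R]_m)
    (q : 'I_T -> R -> 'cV[R]_m) (p : 'cV[R]_m) (e : R) (x : 'I_T -> R)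
    : set 'cV[R]_m :=
  [set X | budget p e X /\ GARP (extend P p) (extend (fun t => q t (x t)) X)].

Definition supportKH (R : realType) (m T : nat) (P Xobs : 'I_T -> 'cV[R]_m)
    (p : 'cV[R]_m) (e : R) : set 'cV[R]_m :=
  [set X | budget p e X /\ HARP (extend P p) (extend Xobs X)].

Definition intersection_demand (R : realType) (m T : nat)
    (q : 'I_T -> R -> 'cV[R]_m) (p : 'cV[R]_m) (e : R) (x : 'I_T -> R) : Prop :=
  forall t, 0 < x t /\ dotv p (q t (x t)) = e.

Definition vec3 (R : realType) (a b c : R) : 'cV[R]_3 :=
  \col_(i < 3) [:: a; b; c]`_i.

(* Indices of 'I_3 start at 0: ex_price 0, 1, 2 are P^1, P^2, P^3. *)
Definition ex_price (R : realType) (t : 'I_3) : 'cV[R]_3 :=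
  [:: vec3 2 1 4; vec3 2 1 2; vec3 2 2 1]`_t.

Definition ex_engel (R : realType) (t : 'I_3) (x : R) : 'cV[R]_3 :=
  x *: [:: vec3 1 0 0; vec3 0 1 0; vec3 0 0 1]`_t.

(* Main.v *)
Require Import Defs.
From mathcomp Require Import all_boot all_order all_algebra.
From mathcomp Require Import boolp classical_sets reals.
From Stdlib Require Import Relation_Operators.
From mathcomp Require Import lra.

Set Implicit Arguments.
Unset Strict Implicit.
Unset Printing Implicit Defensive.

Import Order.TTheory GRing.Theory Num.Theory.
Local Open Scope classical_set_scope.
Local Open Scope ring_scope.

(** With P^4 = (1,1,1) and X = (a,b,c) on the budget a + b + c = 2, everything
    is read off the 4 x 4 table of costs <P^t, X^s>.

    GARP.  At the intersection demands 2 e_t every bundle costs 2 at P^4, so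
    X is revealed preferred to all of them, and GARP forces
    <P^t, 2 e_t> <= <P^t, X>; for t = 1 this is a <= 2 - 3b/2.  Conversely,
    under that inequality b < 2, so observation 2 is revealed preferred to
    itself only, and no pair (t, s) other than (2, 1) can violate GARP.

    HARP.  The cycle 1 -> 2 -> 4 -> 1 at the demands e_t gives
    1 * (4 - b) * 1 >= 2 * 1 * 2, that is b = 0.  Conversely, if b = 0, the
    potential u = (1, 1/2, 1, 2) satisfies
    <P^t, X^s> / <P^t, X^t> >= u_s / u_t for all t, s, and the right-hand
    sides multiply to 1 around any cycle.  The point (0,1,1) separates the two
    sets.

    SARP.  The same point X = (0,1,1) is in the support set at the intersection
    demands, but at x = (2, 3, 1) the cycle X R X^1 R X^2 R X appears: raising
    x_2 from 2 to 3 keeps 2 e_1 revealed preferred to x_2 e_2 and makes x_2 e_2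
    just as expensive as X at the prices P^2. *)

(** * Revealed preference in general *)

(** The transitive closure is the least transitive relation above the revealed
    one; a decidable Q bounding it from above reduces GARP and SARP to finitely
    many comparisons of costs. *)
Lemma revealed_star_min (R : realType) (m T : nat) (P X : 'I_T -> 'cV[R]_m)
    (Q : rel 'I_T) :
  transitive Q -> (forall t s, revealed P X t s -> Q t s) ->
  forall t s, revealed_star P X t s -> Q t s.
Proof.
move=> Qtr RQ t s; elim=> [x y /RQ // | x y z _ Qxy _ Qyz].
exact: Qtr Qxy Qyz.
Qed.

(** The potential u telescopes: around a cycle the values u (t i) and
    u (t (ordS i)) have the same product, since ordS is a bijection. *)
Lemma potential_HARP (R : realType) (m T : nat) (P X : 'I_T -> 'cV[R]_m)
    (u : 'I_T -> R) :
  (forall t, 0 < u t) -> (forall t, 0 <= dotv (P t) (X t)) ->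
  (forall t s, dotv (P t) (X t) * u s <= dotv (P t) (X s) * u t) ->
  HARP P X.
Proof.
move=> u_gt0 diag_ge0 u_le k t.
have U_gt0 : 0 < \prod_(i < k) u (t i) by apply: prodr_gt0.
rewrite -(ler_pM2r U_gt0).
have {1}-> : \prod_(i < k) u (t i) = \prod_(i < k) u (t (ordS i)).
  exact: (reindex (@ordS k) (onW_bij _ (@ordS_bij k))).
rewrite -!big_split /=; apply: ler_prod => i _.
by rewrite u_le mulr_ge0 // ltW.
Qed.

(** * The cost table of the example *)

Lemma dotv_vec3 (R : realType) (a b c : R) (X : 'cV[R]_3) :
  dotv (vec3 a b c) X = a * X 0 0 + b * X 1 0 + c * X 2 0.
Proof.
rewrite /dotv !big_ord_recl big_ord0 !mxE /= addr0 addrA.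
by congr (_ + _ * X _ _ + _ * X _ _); apply: val_inj.
Qed.

Lemma scale_vec3 (R : realType) (k a b c : R) :
  k *: vec3 a b c = vec3 (k * a) (k * b) (k * c).
Proof. by apply/colP; case=> [[|[|[|//]]] i]; rewrite !mxE. Qed.

Lemma extend3 (V : Type) (v : 'I_3 -> V) (w : V) (i : 'I_4) :
  extend v w i = nth w [:: v 0; v 1; v 2] i.
Proof.
rewrite /extend; case: unliftP => [j ->|->] //=.
by case: j => [[|[|[|//]]] j] /=; congr v; apply: val_inj.
Qed.

Lemma orthant_vec3 (R : realType) (a b c : R) :
  0 <= a -> 0 <= b -> 0 <= c -> 0 < a + b + c -> orthant (vec3 a b c).
Proof.
move=> a0 b0 c0 abc; split; first by case=> [[|[|[|//]]] i]; rewrite !mxE.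
apply/eqP => /colP v0; move: (v0 0) (v0 1) (v0 2); rewrite !mxE /= => *; lra.
Qed.

(** Entry (t, s) is the cost at the prices of observation t of the bundle of
    observation s, the bundles being x_1 e_1, x_2 e_2, x_3 e_3 and X. *)
Definition cost (R : realType) (x : 'I_3 -> R) (X : 'cV[R]_3) (t s : nat) : R :=
  (nth [::]
    [:: [:: 2 * x 0; x 1; 4 * x 2; 2 * X 0 0 + X 1 0 + 4 * X 2 0];
        [:: 2 * x 0; x 1; 2 * x 2; 2 * X 0 0 + X 1 0 + 2 * X 2 0];
        [:: 2 * x 0; 2 * x 1; x 2; 2 * X 0 0 + 2 * X 1 0 + X 2 0];
        [:: x 0; x 1; x 2; X 0 0 + X 1 0 + X 2 0]] t)`_s.

(** All revealed preference conditions below become linear arithmetic on this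
    table, for any parameters x of the Engel curves. *)
Lemma ex_cost (R : realType) (x : 'I_3 -> R) (X : 'cV[R]_3) (t s : 'I_4) :
  dotv (extend (@ex_price R) (vec3 1 1 1) t)
       (extend (fun i => ex_engel i (x i)) X s) = cost x X t s.
Proof.
rewrite !extend3; case: t s => [[|[|[|[|//]]]] t] [[|[|[|[|//]]]] s];
  rewrite /ex_price /ex_engel /= ?scale_vec3 dotv_vec3 ?mxE /cost /=; lra.
Qed.

(** * Engel curves and intersection demands *)

Lemma ex_engel_orthant (R : realType) (t : 'I_3) : engel_curve (@ex_engel R t).
Proof.
move=> x x0; case: t => [[|[|[|//]]] t];
  rewrite /ex_engel /= scale_vec3; apply: orthant_vec3; lra.
Qed.

Lemma ex_engel_normal (R : realType) : weakly_normal (@ex_engel R).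
Proof.
move=> t x x' _ xx' i; case: t => [[|[|[|//]]] t];
  case: i => [[|[|[|//]]] i]; rewrite /ex_engel /= !mxE /=; lra.
Qed.

Lemma ex_intersection (R : realType) (x : 'I_3 -> R) :
  intersection_demand (@ex_engel R) (vec3 1 1 1) 2 x <-> forall t, x t = 2.
Proof.
have dotE t : dotv (vec3 1 1 1) (ex_engel t (x t)) = x t.
  case: t => [[|[|[|//]]] t];
    rewrite /ex_engel /= scale_vec3 dotv_vec3 !mxE /=; lra.
split=> [+ t|+ t] => /(_ t); first by rewrite dotE => -[].
by rewrite dotE => ->.
Qed.

Lemma ex_budgetE (R : realType) (X : 'cV[R]_3) :
  budget (vec3 1 1 1) 2 X <-> orthant X /\ X 2 0 = 2 - X 0 0 - X 1 0.
Proof.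
rewrite /budget /= dotv_vec3.
by split=> -[oX e]; split=> //; lra.
Qed.

(** * The GARP and HARP support sets *)

Lemma ex_supportG (R : realType) :
  supportG (@ex_price R) (@ex_engel R) (vec3 1 1 1) 2 (fun=> 2) =
    [set X : 'cV[R]_3 | orthant X /\
       [/\ 0 <= X 0 0, 0 <= X 1 0, X 0 0 <= 2 - 3 / 2 * X 1 0 &
           X 2 0 = 2 - X 0 0 - X 1 0]].
Proof.
apply/seteqP; split=> X /=.
  case=> /ex_budgetE[oX X2] garp; split=> //.
  have X0 := oX.1 0; have X1 := oX.1 1; rewrite !mxE in X0 X1.
  (* The bound on X 0 0 is the GARP inequality at the prices P^1 for the pair
     (4, 1). *)
  have R41 : revealed_star (extend (@ex_price R) (vec3 1 1 1))
      (extend (fun t => ex_engel t 2) X) ord_max ord0.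
    by apply: t_step; rewrite /revealed !(ex_cost (fun=> 2)) /cost /=; lra.
  move: (garp _ _ R41); rewrite !(ex_cost (fun=> 2)) /cost /= => cost_le.
  by split=> //; lra.
case=> oX [X0 X1 X01 X2]; split; first exact/ex_budgetE.
(* Observation 2, of index 1, is revealed preferred to itself only: in
   particular not to observation 1, which would violate GARP. *)
pose Q : rel 'I_4 := fun t s => (val t == 1%N) ==> (val s == 1%N).
have Qtr : transitive Q by move=> b a c /implyP ab /implyP bc; apply/implyP; auto.
move=> t s /(revealed_star_min Qtr) Qts.
have {Qts} : Q t s.
  apply: Qts => {}t {}s; rewrite /revealed !(ex_cost (fun=> 2)) /cost /Q.
  case: t s => [[|[|[|[|//]]]] t] [[|[|[|[|//]]]] s] //=; lra.
rewrite !(ex_cost (fun=> 2)) /cost /Q.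
case: t s => [[|[|[|[|//]]]] t] [[|[|[|[|//]]]] s] //=; lra.
Qed.

Lemma ex_supportKH (R : realType) :
  supportKH (@ex_price R) (fun t => ex_engel t 1) (vec3 1 1 1) 2 =
    [set X : 'cV[R]_3 | orthant X /\
       [/\ X 1 0 = 0, 0 <= X 0 0 <= 2 & X 2 0 = 2 - X 0 0]].
Proof.
apply/seteqP; split=> X /=.
  case=> /ex_budgetE[oX X2] harp; split=> //.
  have X0 := oX.1 0; have X1 := oX.1 1; have := oX.1 2.
  rewrite !mxE in X0 X1 *.
  (* The cycle 1 -> 2 -> 4 -> 1 bounds X 1 0 above by 0. *)
  have := harp 3%N (fun i => nth ord_max [:: ord0; 1; ord_max] i).
  rewrite !big_ord_recr !big_ord0 /= !(ex_cost (fun=> 1)) /cost /= => h c0.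
  by split=> //; lra.
case=> oX [X1 /andP[X0 X02] X2]; split; first by apply/ex_budgetE; split=> //; lra.
(* The cycle 0 -> 1 -> 3 -> 0 of indices has equality at each of its three
   steps, which fixes u on them up to a factor. *)
apply: (@potential_HARP _ _ _ _ _ (fun t => [:: 1; 2^-1; 1; 2]`_t)).
- by case=> [[|[|[|[|//]]]] t] /=; lra.
- by case=> [[|[|[|[|//]]]] t] /=; rewrite (ex_cost (fun=> 1)) /cost /=; lra.
- by case=> [[|[|[|[|//]]]] t] [[|[|[|[|//]]]] s];
    rewrite !(ex_cost (fun=> 1)) /cost /=; lra.
Qed.

Lemma ex_supportKH_proper (R : realType) :
  supportKH (@ex_price R) (fun t => ex_engel t 1) (vec3 1 1 1) 2 `<`
  supportG (@ex_price R) (@ex_engel R) (vec3 1 1 1) 2 (fun=> 2).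
Proof.
rewrite ex_supportKH ex_supportG properEneq; split; last first.
  by move=> X /= [oX [X1 /andP[X0 X02] X2]]; split=> //; split; lra.
apply/eqP => /seteqP[_ /(_ (vec3 0 1 1))] /=.
rewrite !mxE /=; case; last by move=> _ [+ _ _]; lra.
by split; [apply: orthant_vec3; lra | split; lra].
Qed.

(** * Failure of the inclusion for SARP *)

Lemma ex_supportS_tilde (R : realType) :
  supportS (@ex_price R) (@ex_engel R) (vec3 1 1 1) 2 (fun=> 2) (vec3 0 1 1).
Proof.
split.
  by apply/ex_budgetE; split; [apply: orthant_vec3; lra | rewrite !mxE /=; lra].
(* Beyond the diagonal, only X is revealed preferred to everything, and 2 e_1
   to 2 e_2.  Nothing else is preferred to X, which costs as much as the other
   bundles at P^4 and so could not be strictly dearer. *)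
pose Q : rel 'I_4 := fun t s =>
  [|| val t == val s, val t == 3%N | (val t == 0%N) && (val s == 1%N)].
have Qtr : transitive Q.
  by case=> [[|[|[|[|//]]]] b] [[|[|[|[|//]]]] a] [[|[|[|[|//]]]] c].
move=> t s /(revealed_star_min Qtr) Qts.
have {Qts} : Q t s.
  apply: Qts => {}t {}s; rewrite /revealed !(ex_cost (fun=> 2)) /cost /Q !mxE.
  case: t s => [[|[|[|[|//]]]] t] [[|[|[|[|//]]]] s] //=; lra.
case: (eqVneq t s) => [-> _ //|+ + _].
rewrite !(ex_cost (fun=> 2)) /cost /Q !mxE -val_eqE.
case: t s => [[|[|[|[|//]]]] t] [[|[|[|[|//]]]] s] //=; lra.
Qed.

(** The bundle 3 e_2 costs 3 at the prices P^2, as much as (0,1,1), so that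
    SARP fails for the pair (4, 2), reached through 2 e_1. *)
Lemma ex_supportS_shifted (R : realType) :
  ~ supportS (@ex_price R) (@ex_engel R) (vec3 1 1 1) 2
      (fun t => [:: 2; 3; 1]`_t) (vec3 0 1 1).
Proof.
set x : 'I_3 -> R := fun t => _; case=> _ sarp.
have R41 : revealed_star (extend (@ex_price R) (vec3 1 1 1))
    (extend (fun t => ex_engel t (x t)) (vec3 0 1 1)) ord_max 0.
  by apply: t_step; rewrite /revealed !(ex_cost x) /cost !mxE /= /x /=; lra.
have R12 : revealed_star (extend (@ex_price R) (vec3 1 1 1))
    (extend (fun t => ex_engel t (x t)) (vec3 0 1 1)) 0 1.
  by apply: t_step; rewrite /revealed !(ex_cost x) /cost !mxE /= /x /=; lra.
have := sarp _ _ (t_trans _ _ _ _ _ R41 R12).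
rewrite !(ex_cost x) /cost !mxE /= /x /= => sarp42.
suff : (3 : R) < 2 * 0 + 1 + 2 * 1 by lra.
apply: sarp42; rewrite !extend3 /= => /colP/(_ 2).
by rewrite !mxE /=; lra.
Qed.

Theorem mainTheorem1 (R : realType) :
  let P : 'I_3 -> 'cV[R]_3 := @ex_price R in
  let q : 'I_3 -> R -> 'cV[R]_3 := @ex_engel R in
  let Xobs : 'I_3 -> 'cV[R]_3 := fun t => q t 1 in
  let P4 : 'cV[R]_3 := vec3 1 1 1 in
  let x4 : R := 2 in
  let xtilde : 'I_3 -> R := fun=> 2 in
  (forall t, engel_curve (q t)) /\
  weakly_normal q /\
  (forall x : 'I_3 -> R,
     intersection_demand q P4 x4 x <-> forall t, x t = xtilde t) /\
  supportG P q P4 x4 xtilde =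
    [set X : 'cV[R]_3 | orthant X /\
       [/\ 0 <= X 0 0, 0 <= X 1 0, X 0 0 <= 2 - 3 / 2 * X 1 0 &
           X 2 0 = 2 - X 0 0 - X 1 0]] /\
  supportKH P Xobs P4 x4 =
    [set X : 'cV[R]_3 | orthant X /\
       [/\ X 1 0 = 0, 0 <= X 0 0 <= 2 & X 2 0 = 2 - X 0 0]] /\
  supportKH P Xobs P4 x4 `<` supportG P q P4 x4 xtilde /\
  ~ (forall x : 'I_3 -> R, (forall t, 0 < x t) ->
       supportS P q P4 x4 xtilde `<=` supportS P q P4 x4 x).
Proof.
split; first exact: ex_engel_orthant.
split; first exact: ex_engel_normal.
split; first exact: ex_intersection.
split; first exact: ex_supportG.
split; first exact: ex_supportKH.
split; first exact: ex_supportKH_proper.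
move=> /(_ (fun t => [:: 2; 3; 1]`_t)) incl.
apply: (@ex_supportS_shifted R); apply: incl; last exact: ex_supportS_tilde.
by case=> [[|[|[|//]]] t] /=; lra.
Qed.
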